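(* Every test for deterministic devices, with input system $A$, output system $A'$ and performance operator $\Omega$, is equivalent to a canonical test of the following form: 1. Choose a mixed state $\tau_A$ of system $A$, with the property that the operator $I_{A'}\otimes\tau_A$ is invertible on the support of the operator $\Omega^{T_A}$, where $T_A$ denotes the partial transpose on system $A$. 2. Prepare a purification of $\tau_A$, denoted by $|\Psi\rangle_{AR}$, with purifying system $R$. 3. Apply the tested channel $\mathcal C$ on system $A$. 4. Measure systems $A'$ and $R$ with the observable $$O=\left(I_{A'}\otimes\tau_R^{-1/2}\,T_{AR}^\dagger\right)\,\Omega^{T_A}\,\left(I_{A'}\otimes T_{AR}\,\tau_R^{-1/2}\right),$$ where $\tau_R=\operatorname{Tr}_A[|\Psi\rangle\langle\Psi|_{AR}]$ is the marginal of $|\Psi\rangle_{AR}$ on system $R$, and $T_{AR}$ is the partial isometry such that $T_{AR}^\dagger\,\tau_A\,T_{AR}=\tau_R$.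
   Context: A quantum channel (deterministic device) is a completely positive trace-preserving linear map. A test for deterministic devices consists of the preparation of a joint state (density operator) $\sigma_{AR_0}$ of the input system $A$ and a reference system $R_0$, the application of the tested channel $\mathcal C$ (from $A$ to $A'$) on $A$, and the measurement of an observable $O^{(0)}$ on $A'R_0$; its score on $\mathcal C$ is the expectation value $\operatorname{Tr}[O^{(0)}(\mathcal C\otimes\mathcal I_{R_0})(\sigma_{AR_0})]$. Two tests are equivalent if they assign the same score to all channels $\mathcal C$ from $A$ to $A'$. The performance operator of the test is the operator $\Omega=\operatorname{Tr}_{R_0}[(O^{(0)}_{A'R_0}\otimes I_A)(I_{A'}\otimes\sigma_{AR_0})]$ on $\mathcal H_{A'}\otimes\mathcal H_A$ (Hilbert spaces rearranged in the appropriate order so that the operators can be multiplied). The partial isometry $T_{AR}$ maps each eigenvector of $\tau_R$ into the corresponding eigenvector of $\tau_A$: if $\tau_A=\sum_n\lambda_n|\phi_n\rangle\langle\phi_n|$ and $|\Psi\rangle_{AR}=\sum_n\sqrt{\lambda_n}\,|\phi_n\rangle_A\otimes|\psi_n\rangle_R$ is the Schmidt decomposition (with $\{|\psi_n\rangle\}$ orthonormal), then $\tau_R=\sum_n\lambda_n|\psi_n\rangle\langle\psi_n|$ and $T_{AR}=\sum_n|\phi_n\rangle_A\langle\psi_n|_R$. The invertibility requirement on $\tau_A$ serves to make the products with inverse powers of $\tau$ well defined. *)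

(* Defs.v *)
From HB Require Import structures.
From mathcomp Require Import all_boot all_order all_algebra.
From mathcomp Require Import reals.
From mathcomp Require Export complex mxtens.

Set Implicit Arguments.
Unset Strict Implicit.
Unset Printing Implicit Defensive.

Import Order.TTheory GRing.Theory Num.Theory.
Local Open Scope ring_scope.
Local Open Scope sesquilinear_scope.

(* All Hilbert spaces are finite-dimensional: a system of dimension m is C^m,  *)
(* kets are column vectors, M^t* is the adjoint, and the composite of systems  *)
(* of dimensions m and n is C^(m * n), indexed through mxtens_index, so that   *)
(* *t is the tensor product.                                                   *)

Section Operators.
Variable C : numClosedFieldType.

Definition psdmx n (M : 'M[C]_n) : Prop :=
  M \is hermsymmx /\ forall v : 'cV[C]_n, 0 <= (v^t* *m M *m v) 0 0.

Definition densitymx n (M : 'M[C]_n) : Prop := psdmx M /\ \tr M = 1.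

(* For X on an m-dimensional system tensored with a k-dimensional one, the     *)
(* X_rs of X = \sum_(r, s) X_rs *t |r><s|.                                     *)
Definition tens_block m k (r s : 'I_k) (X : 'M[C]_(m * k)) : 'M[C]_m :=
  mxsub (fun a => mxtens_index (a, r)) (fun b => mxtens_index (b, s)) X.

Definition ptrace1 m k (X : 'M[C]_(m * k)) : 'M[C]_k :=
  \sum_(a < m) mxsub (fun r => mxtens_index (a, r))
                     (fun s => mxtens_index (a, s)) X.

Definition ptrace2 m k (X : 'M[C]_(m * k)) : 'M[C]_m :=
  \sum_(r < k) tens_block r r X.

(* Partial transpose of the second factor in the computational basis. *)
Definition ptranspose2_std m k (X : 'M[C]_(m * k)) : 'M[C]_(m * k) :=
  \matrix_(i, j)
    X (mxtens_index ((mxtens_unindex i).1, (mxtens_unindex j).2))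
      (mxtens_index ((mxtens_unindex j).1, (mxtens_unindex i).2)).

(* Partial transpose of the second factor with respect to the orthonormal      *)
(* basis formed by the columns of the unitary matrix U.                        *)
Definition ptranspose2 m k (U : 'M[C]_k) (X : 'M[C]_(m * k)) : 'M[C]_(m * k) :=
  (1%:M *t U) *m ptranspose2_std ((1%:M *t U^t* ) *m X *m (1%:M *t U))
    *m (1%:M *t U^t* ).

(* Supp X is included in Supp M, for self-adjoint X and M. The support is then *)
(* the span of the columns, i.e. the row space of the transpose. Under this    *)
(* inclusion the inverse of M on its own support inverts M on Supp X; mere     *)
(* injectivity of M on Supp X would not suffice for M^-1/2 X M^-1/2 to         *)
(* determine X.                                                                *)
Definition invertible_on_support n (M X : 'M[C]_n) : Prop :=
  (X^T <= M^T)%MS.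

(* M^(-1/2) for M positive semidefinite, by functional calculus; as 0^-1 = 0   *)
(* it vanishes on the kernel of M.                                             *)
Definition inv_sqrtmx n (M : 'M[C]_n) : 'M[C]_n :=
  invmx (spectralmx M)
    *m diag_mx (map_mx (fun x => (sqrtC x)^-1) (spectral_diag M))
    *m spectralmx M.

Definition partial_isometry m n (T : 'M[C]_(m, n)) : Prop :=
  T *m T^t* *m T = T.

End Operators.

Section Channels.
Variable C : numClosedFieldType.

(* N tensored with the identity channel on a k-dimensional system. *)
Definition chan_ext m n (N : 'M[C]_m -> 'M[C]_n) k (X : 'M[C]_(m * k)) :
    'M[C]_(n * k) :=
  \sum_(r < k) \sum_(s < k) N (tens_block r s X) *t delta_mx r s.

Definition completely_positive m n (N : 'M[C]_m -> 'M[C]_n) : Prop :=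
  forall k (X : 'M[C]_(m * k)), psdmx X -> psdmx (chan_ext N X).

Definition trace_preserving m n (N : 'M[C]_m -> 'M[C]_n) : Prop :=
  forall X, \tr (N X) = \tr X.

Definition channel m n (N : {linear 'M[C]_m -> 'M[C]_n}) : Prop :=
  completely_positive N /\ trace_preserving N.

End Channels.

Section Tests.
Variable C : numClosedFieldType.

Record test (dA dA' : nat) := Test {
  test_refdim : nat;
  test_state : 'M[C]_(dA * test_refdim);
  test_obs : 'M[C]_(dA' * test_refdim);
  test_stateP : densitymx test_state;
  test_obsP : test_obs \is hermsymmx
}.

Definition score dA dA' (t : test dA dA') (N : 'M[C]_dA -> 'M[C]_dA') : C :=
  \tr (test_obs t *m chan_ext N (test_state t)).

Definition test_equiv dA dA' (t1 t2 : test dA dA') : Prop :=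
  forall N : {linear 'M[C]_dA -> 'M[C]_dA'}, channel N ->
    score t1 N = score t2 N.

(* Rearrangements of tensor factors: (i, a, r) to (i, r, a) and to (i, (a, r)). *)
Definition swap23 m n k (x : 'I_(m * n * k)) : 'I_(m * k * n) :=
  let ia := mxtens_unindex (mxtens_unindex x).1 in
  mxtens_index (mxtens_index (ia.1, (mxtens_unindex x).2), ia.2).

Definition assoc23 m n k (x : 'I_(m * n * k)) : 'I_(m * (n * k)) :=
  let ia := mxtens_unindex (mxtens_unindex x).1 in
  mxtens_index (ia.1, mxtens_index (ia.2, (mxtens_unindex x).2)).

(* Tr_R0 [(O tensor I_A)(I_A' tensor sigma)], both factors being brought to the *)
(* order A', A, R0 before they are multiplied.                                 *)
Definition performance dA dA' (t : test dA dA') : 'M[C]_(dA' * dA) :=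
  let f := @swap23 dA' dA (test_refdim t) in
  let g := @assoc23 dA' dA (test_refdim t) in
  ptrace2 (mxsub f f (test_obs t *t (1%:M : 'M[C]_dA))
           *m mxsub g g ((1%:M : 'M[C]_dA') *t test_state t)).

End Tests.

Section CanonicalTests.
Variable C : numClosedFieldType.

(* tau = \sum_n lam_n |phi_n><phi_n| with phi_n the n-th column of phi. *)
Definition spectral_decomp dA (tau : 'M[C]_dA) (lam : 'rV[C]_dA)
    (phi : 'M[C]_dA) : Prop :=
  phi \is unitarymx /\ tau = phi *m diag_mx lam *m phi^t*.

Definition purification dA dR (tau : 'M[C]_dA) (Psi : 'cV[C]_(dA * dR)) : Prop :=
  ptrace2 (Psi *m Psi^t* ) = tau.

(* Psi = \sum_n sqrt lam_n phi_n *t psi_n with psi_n the n-th column of psi.   *)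
(* Only the psi_n with lam_n != 0 matter, and only these are constrained (R    *)
(* may have a smaller dimension than A).                                       *)
Definition schmidt_decomp dA dR (Psi : 'cV[C]_(dA * dR)) (lam : 'rV[C]_dA)
    (phi : 'M[C]_dA) (psi : 'M[C]_(dR, dA)) : Prop :=
  (forall m n, lam 0 m != 0 -> lam 0 n != 0 ->
     (psi^t* *m psi) m n = (m == n)%:R) /\
  Psi = \sum_(n < dA) sqrtC (lam 0 n) *: (col n phi *t col n psi).

(* T_AR = \sum_n |phi_n><psi_n| over the terms of the Schmidt decomposition.   *)
Definition eigen_isometry dA dR (lam : 'rV[C]_dA) (phi : 'M[C]_dA)
    (psi : 'M[C]_(dR, dA)) : 'M[C]_(dA, dR) :=
  \sum_(n < dA | lam 0 n != 0) col n phi *m (col n psi)^t*.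

(* X stands for the partial transpose of the performance operator, which has   *)
(* to be taken in the same eigenbasis phi of tau as T: in an unrelated basis   *)
(* the resulting test is in general not equivalent to the original one.        *)
Definition canonical_obs dA' dA dR (X : 'M[C]_(dA' * dA)) (T : 'M[C]_(dA, dR))
    (tauR : 'M[C]_dR) : 'M[C]_(dA' * dR) :=
  ((1%:M : 'M[C]_dA') *t (inv_sqrtmx tauR *m T^t* )) *m X
    *m ((1%:M : 'M[C]_dA') *t (T *m inv_sqrtmx tauR)).

End CanonicalTests.

(* Main.v *)
(* The score of a test depends on the tested channel N only through the pairing
   \sum_(c, d) tr (Omega_cd N(|c><d|)), Omega_cd being the blocks of the
   performance operator, so two tests with the same performance operator are
   equivalent. A pure state Psi corresponds to a dA x dR matrix P of amplitudes;
   for the state |Psi><Psi| and the observable O the partial transpose of the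
   performance operator is the sandwich of O between conj P and P^T on the
   second factor. In Schmidt form, T tauR^(-1/2) P^T = E U, with E the projector
   onto the support of tau and U = phi phi^T, a unitary which turns the
   transpose in the basis phi into the transpose in the computational basis. The
   support condition makes E act trivially on the transpose of Omega, so the
   canonical test has performance operator Omega. *)

Require Import Defs.
From HB Require Import structures.
From mathcomp Require Import all_boot all_order all_algebra.
From mathcomp Require Import reals.

Set Implicit Arguments.
Unset Strict Implicit.
Unset Printing Implicit Defensive.

Import Order.TTheory GRing.Theory Num.Theory.
Local Open Scope ring_scope.
Local Open Scope sesquilinear_scope.

(** * Adjoints, and operators acting on the second tensor factor only *)

Lemma hermsymmxP (C : numClosedFieldType) n (M : 'M[C]_n) :
  M \is hermsymmx <-> M^t* = M.
Proof.
split=> [/is_hermitianmxP|MM]; first by rewrite expr0 scale1r => <-.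
by apply/is_hermitianmxP; rewrite expr0 scale1r MM.
Qed.

Lemma adjmxM (C : numClosedFieldType) m n p (A : 'M[C]_(m, n)) (B : 'M_(n, p)) :
  (A *m B)^t* = B^t* *m A^t*.
Proof. by rewrite trmx_mul map_mxM. Qed.

Lemma adjmxE (C : numClosedFieldType) m n (A : 'M[C]_(m, n)) i j :
  A^t* i j = (A j i)^*.
Proof. by rewrite !mxE. Qed.

Lemma tens1mx_adj (C : numClosedFieldType) m k p (A : 'M[C]_(k, p)) :
  ((1%:M : 'M[C]_m) *t A)^t* = 1%:M *t A^t*.
Proof. by rewrite trmx_tens map_mxT trmx1 map_mx1. Qed.

Lemma tens1mxM (C : numClosedFieldType) m k p q (A : 'M[C]_(k, p))
    (B : 'M[C]_(p, q)) :
  ((1%:M : 'M[C]_m) *t A) *m (1%:M *t B) = 1%:M *t (A *m B).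
Proof. by rewrite tensmx_mul mulmx1. Qed.

Lemma matrix_tensP (C : numClosedFieldType) m n p q
    (X Y : 'M[C]_(m * n, p * q)) :
  (forall a r b s, X (mxtens_index (a, r)) (mxtens_index (b, s)) =
                   Y (mxtens_index (a, r)) (mxtens_index (b, s))) -> X = Y.
Proof.
move=> XY; apply/matrixP => i j.
by rewrite -(mxtens_unindexK i) -(mxtens_unindexK j) XY.
Qed.

Lemma tens1mx1 (C : numClosedFieldType) m k :
  (1%:M : 'M[C]_m) *t (1%:M : 'M[C]_k) = 1%:M.
Proof.
apply: matrix_tensP => a r b s.
rewrite tensmxE !mxE -natrM mulnb -[(a == b) && _]/((a, r) == (b, s)).
by rewrite (inj_eq (can_inj (@mxtens_indexK m k))).
Qed.

Lemma tens1mx_sandwich (C : numClosedFieldType) m k p q (A : 'M[C]_(p, q))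
    (B : 'M[C]_(q, k)) (B' : 'M[C]_(k, q)) (A' : 'M[C]_(q, p))
    (X : 'M[C]_(m * k)) :
  (1%:M *t A) *m ((1%:M *t B) *m X *m (1%:M *t B')) *m (1%:M *t A') =
  (1%:M *t (A *m B)) *m X *m (1%:M *t (B' *m A')).
Proof. by rewrite !mulmxA tens1mxM -mulmxA tens1mxM. Qed.

Lemma big_mxtens (V : nmodType) m n (F : 'I_(m * n) -> V) :
  \sum_k F k = \sum_i \sum_j F (mxtens_index (i, j)).
Proof.
rewrite pair_big_dep /= (reindex (@mxtens_index m n)) /=; last first.
  by exists (@mxtens_unindex m n) => ? _;
    rewrite ?mxtens_indexK ?mxtens_unindexK.
by apply: eq_bigr => -[].
Qed.

(** * Block decomposition and partial transposition *)

Lemma tens_blockE (C : numClosedFieldType) m k r s (X : 'M[C]_(m * k)) a b :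
  tens_block r s X a b = X (mxtens_index (a, r)) (mxtens_index (b, s)).
Proof. by rewrite mxE. Qed.

Lemma tens_block_inj (C : numClosedFieldType) m k (X Y : 'M[C]_(m * k)) :
  (forall r s, tens_block r s X = tens_block r s Y) -> X = Y.
Proof.
move=> XY; apply: matrix_tensP => a r b s.
by have := congr1 (fun M : 'M_m => M a b) (XY r s); rewrite !mxE.
Qed.

Lemma tens1mx_mull (C : numClosedFieldType) m k p q (A : 'M[C]_(k, p))
    (X : 'M[C]_(m * p, q)) a r j :
  (((1%:M : 'M[C]_m) *t A) *m X) (mxtens_index (a, r)) j =
  \sum_c A r c * X (mxtens_index (a, c)) j.
Proof.
rewrite mxE big_mxtens (bigD1 a) //= [X in _ + X]big1 ?addr0 => [|i /negPf ia].
  by apply: eq_bigr => c _; rewrite tensmxE mxE eqxx mul1r.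
by apply: big1 => c _; rewrite tensmxE mxE eq_sym ia !mul0r.
Qed.

Lemma tens1mx_mulr (C : numClosedFieldType) m k p q (A : 'M[C]_(p, k))
    (X : 'M[C]_(q, m * p)) a r j :
  (X *m ((1%:M : 'M[C]_m) *t A)) j (mxtens_index (a, r)) =
  \sum_c A c r * X j (mxtens_index (a, c)).
Proof.
rewrite mxE big_mxtens (bigD1 a) //= [X in _ + X]big1 ?addr0 => [|i /negPf ia].
  by apply: eq_bigr => c _; rewrite tensmxE mxE eqxx mul1r mulrC.
by apply: big1 => c _; rewrite tensmxE mxE ia mul0r mulr0.
Qed.

(** The blocks are the coefficients of [X] in the matrix units of the second factor, so operators on
    that factor only mix them with scalar weights. *)
Lemma tens_block_sandwich (C : numClosedFieldType) m k p (A : 'M[C]_(p, k))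
    (B : 'M[C]_(k, p)) (X : 'M[C]_(m * k)) r s :
  tens_block r s ((1%:M *t A) *m X *m (1%:M *t B)) =
  \sum_c \sum_d (A r c * B d s) *: tens_block c d X.
Proof.
apply/matrixP => a b; rewrite mxE tens1mx_mulr summxE.
under [RHS]eq_bigr => c _ do rewrite summxE.
rewrite exchange_big /=; apply: eq_bigr => d _.
rewrite tens1mx_mull mulr_sumr; apply: eq_bigr => c _.
by rewrite !mxE mulrA (mulrC (B d s)).
Qed.

Lemma tens_block_adj (C : numClosedFieldType) m k (X : 'M[C]_(m * k)) r s :
  tens_block r s (X^t* ) = (tens_block s r X)^t*.
Proof. by apply/matrixP => a b; rewrite !mxE. Qed.

Lemma tens_block_ptranspose2_std (C : numClosedFieldType) m k
    (X : 'M[C]_(m * k)) r s :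
  tens_block r s (ptranspose2_std X) = tens_block s r X.
Proof. by apply/matrixP => a b; rewrite !mxE !mxtens_indexK. Qed.

Lemma ptranspose2_std_adj (C : numClosedFieldType) m k (X : 'M[C]_(m * k)) :
  (ptranspose2_std X)^t* = ptranspose2_std (X^t* ).
Proof.
apply: tens_block_inj => r s.
by rewrite tens_block_adj !tens_block_ptranspose2_std tens_block_adj.
Qed.

Lemma ptranspose2_herm (C : numClosedFieldType) m k (U : 'M[C]_k)
    (X : 'M[C]_(m * k)) :
  X^t* = X -> (ptranspose2 U X)^t* = ptranspose2 U X.
Proof.
move=> XX; rewrite /ptranspose2 !adjmxM ptranspose2_std_adj !adjmxM XX.
by rewrite !tens1mx_adj trmxCK !mulmxA.
Qed.

(** * Scores as linear functions of the performance operator *)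

(** This is the trace of [ptranspose2_std X] against the Choi operator of [N]. *)
Definition pairing (C : numClosedFieldType) m n
    (N : 'M[C]_m -> 'M[C]_n) (X : 'M[C]_(n * m)) : C :=
  \sum_c \sum_d \tr (tens_block c d X *m N (delta_mx c d)).

(** Tracing against |r><s| on the reference system selects the block of [Y] with the two indices
    exchanged. *)
Lemma tr_chan_ext (C : numClosedFieldType) m n (N : 'M[C]_m -> 'M[C]_n) k
    (X : 'M[C]_(m * k)) (Y : 'M[C]_(n * k)) :
  \tr (Y *m chan_ext N X) =
  \sum_r \sum_s \tr (tens_block s r Y *m N (tens_block r s X)).
Proof.
rewrite mulmx_sumr raddf_sum /=; apply: eq_bigr => r _.
rewrite mulmx_sumr raddf_sum /=; apply: eq_bigr => s _.
rewrite /mxtrace big_mxtens; apply: eq_bigr => a _.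
rewrite (bigD1 s) //= big1 ?addr0 => [|c /negPf cs].
  rewrite !mxE big_mxtens; apply: eq_bigr => b _.
  rewrite (bigD1 r) //= big1 ?addr0 => [|c /negPf cr].
    by rewrite tensmxE [delta_mx _ _ _ _]mxE !eqxx mulr1 tens_blockE.
  by rewrite tensmxE [delta_mx _ _ _ _]mxE cr !mulr0.
rewrite mxE big_mxtens big1 // => b _; rewrite big1 // => d _.
by rewrite tensmxE [delta_mx _ _ _ _]mxE cs andbF !mulr0.
Qed.

(** In the matrix product the identity factors force the intermediate output index to be [j] and the
    intermediate input index to be [c]; only the reference index [s] stays summed. *)
Lemma performanceE (C : numClosedFieldType) dA dA' (t : test C dA dA') i c j d :
  performance t (mxtens_index (i, c)) (mxtens_index (j, d)) =
  \sum_r \sum_s test_obs t (mxtens_index (i, r)) (mxtens_index (j, s))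
                * test_state t (mxtens_index (c, s)) (mxtens_index (d, r)).
Proof.
rewrite summxE; apply: eq_bigr => r _; rewrite tens_blockE mxE big_mxtens.
rewrite big_mxtens (bigD1 j) //= [X in _ + X]big1 ?addr0 => [|i' /negPf i'j].
  rewrite (bigD1 c) //= [X in _ + X]big1 ?addr0 => [|c' /negPf c'c].
    apply: eq_bigr => s _.
    rewrite !mxE /swap23 /assoc23 !mxtens_indexK /=.
    by rewrite !eqxx mulr1 mul1r.
  apply: big1 => s _.
  rewrite !mxE /swap23 /assoc23 !mxtens_indexK /=.
  by rewrite eq_sym c'c mulr0 mul0r.
apply: big1 => c' _; apply: big1 => s _.
rewrite !mxE /swap23 /assoc23 !mxtens_indexK /=.
by rewrite i'j mul0r mulr0.
Qed.

(** The two multiplied operators need not commute, but conjugating the entries merely exchanges the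
    two summed reference indices. *)
Lemma performance_herm (C : numClosedFieldType) dA dA' (t : test C dA dA') :
  (performance t)^t* = performance t.
Proof.
have [[/hermsymmxP sH _] _] := test_stateP t.
have /hermsymmxP oH := test_obsP t.
apply: matrix_tensP => i c j d.
rewrite adjmxE !performanceE exchange_big rmorph_sum; apply: eq_bigr => r _.
rewrite rmorph_sum; apply: eq_bigr => s _.
by rewrite rmorphM /= -!adjmxE oH sH.
Qed.

Lemma score_performance (C : numClosedFieldType) dA dA' (t : test C dA dA')
    (N : {linear 'M[C]_dA -> 'M[C]_dA'}) :
  score t N = pairing N (performance t).
Proof.
have NE (M : 'M_dA) : N M = \sum_c \sum_d M c d *: N (delta_mx c d).
  rewrite {1}(matrix_sum_delta M) linear_sum; apply: eq_bigr => c _.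
  by rewrite linear_sum; apply: eq_bigr => d _; rewrite linearZ.
have PE c d : tens_block c d (performance t) = \sum_r \sum_s
    tens_block s r (test_state t) c d *: tens_block r s (test_obs t).
  apply/matrixP => i j; rewrite tens_blockE performanceE summxE.
  apply: eq_bigr => r _; rewrite summxE; apply: eq_bigr => s _.
  by rewrite !mxE mulrC.
rewrite /score tr_chan_ext exchange_big /=.
(* The state blocks are expanded in matrix units by linearity of [N]; the sums over [c] and [d] then
   move outside, so that the inner reference sums assemble into the blocks given by [PE]. *)
under eq_bigr => r _ do under eq_bigr => s _ do rewrite NE mulmx_sumr raddf_sum.
under [LHS]eq_bigr => r _ do rewrite exchange_big.
rewrite exchange_big /=; apply: eq_bigr => c _.
under [LHS]eq_bigr => r _ do under eq_bigr => s _ do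
  rewrite mulmx_sumr raddf_sum.
under [LHS]eq_bigr => r _ do rewrite exchange_big.
rewrite exchange_big /=; apply: eq_bigr => d _.
rewrite PE mulmx_suml raddf_sum /=; apply: eq_bigr => r _.
rewrite mulmx_suml raddf_sum /=; apply: eq_bigr => s _.
by rewrite -scalemxAr -scalemxAl !linearZ.
Qed.

(** * Partial transposes in different bases *)

Lemma ptranspose2_std_sandwich (C : numClosedFieldType) m k (A B : 'M[C]_k)
    (X : 'M[C]_(m * k)) :
  ptranspose2_std ((1%:M *t A) *m X *m (1%:M *t B)) =
  (1%:M *t B^T) *m ptranspose2_std X *m (1%:M *t A^T).
Proof.
apply: tens_block_inj => r s.
rewrite tens_block_ptranspose2_std !tens_block_sandwich exchange_big /=.
apply: eq_bigr => c _; apply: eq_bigr => d _.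
by rewrite tens_block_ptranspose2_std !mxE mulrC.
Qed.

Lemma ptranspose2_stdK (C : numClosedFieldType) m k :
  involutive (@ptranspose2_std C m k).
Proof.
by move=> X; apply: tens_block_inj => r s; rewrite !tens_block_ptranspose2_std.
Qed.

(** Transposition moves the inner basis changes to the opposite sides as transposes, where they
    merge with the outer ones. Hence the dependence on the basis is through [U *m U^T], which is not
    the identity for a general unitary. *)
Lemma ptranspose2E (C : numClosedFieldType) m k (U : 'M[C]_k)
    (X : 'M[C]_(m * k)) :
  ptranspose2 U X = (1%:M *t (U *m U^T)) *m ptranspose2_std X
                      *m (1%:M *t (U *m U^T)^t* ).
Proof.
rewrite /ptranspose2 ptranspose2_std_sandwich !mulmxA tens1mxM.
rewrite -!mulmxA tens1mxM.
by congr (_ *m (_ *m (_ *t _))); rewrite adjmxM map_trmx trmxK.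
Qed.

(** * Positive semidefinite matrices and the inverse square root *)

Lemma psdmx_sandwich_ge0 (C : numClosedFieldType) n p (A : 'M[C]_n)
    (V : 'M[C]_(n, p)) i :
  psdmx A -> 0 <= (V^t* *m A *m V) i i.
Proof.
move=> [_ /(_ (col i V))]; congr (0 <= _).
rewrite !mxE; apply: eq_bigr => k _; rewrite [col i V k 0]mxE; congr (_ * _).
by rewrite !mxE; apply: eq_bigr => j _; rewrite !mxE.
Qed.

Lemma psdmx_mul_adj (C : numClosedFieldType) n p (A : 'M[C]_(n, p)) :
  psdmx (A *m A^t* ).
Proof.
split=> [|v]; first by apply/hermsymmxP; rewrite adjmxM trmxCK.
have -> : v^t* *m (A *m A^t* ) *m v = (A^t* *m v)^t* *m (A^t* *m v).
  by rewrite adjmxM trmxCK !mulmxA.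
rewrite mxE sumr_ge0 // => i _.
by rewrite adjmxE mulrC mul_conjC_ge0.
Qed.

(** The diagonal entries of the product are the squared norms of the rows of [A]. *)
Lemma mulmx_adj_eq0 (C : numClosedFieldType) n p (A : 'M[C]_(n, p)) :
  A *m A^t* = 0 -> A = 0.
Proof.
move=> AA0; apply/matrixP => i j.
have /eqP := congr1 (fun M : 'M_n => M i i) AA0.
rewrite !mxE psumr_eq0 => [|k _]; last by rewrite adjmxE mul_conjC_ge0.
by move=> /allP /(_ j (mem_index_enum _)) /=;
  rewrite adjmxE mul_conjC_eq0 => /eqP.
Qed.

Lemma diag_mx_adj (C : numClosedFieldType) n (d : 'rV[C]_n) :
  (forall i, 0 <= d 0 i) -> (diag_mx d)^t* = diag_mx d.
Proof.
move=> d0; rewrite tr_diag_mx map_diag_mx; congr diag_mx.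
by apply/rowP => i; rewrite mxE; apply: geC0_conj.
Qed.

Lemma spectral_diag_ge0 (C : numClosedFieldType) n (A : 'M[C]_n) i :
  psdmx A -> 0 <= spectral_diag A 0 i.
Proof.
move=> Apsd; have [/hermitian_normalmx/orthomx_spectralP AE _] := Apsd.
have U := spectral_unit A; set P := spectralmx A in AE U.
set d := spectral_diag A in AE *.
have PP : P *m P^t* = 1%:M by apply/unitarymxP/spectral_unitarymx.
have := psdmx_sandwich_ge0 (P^t* ) i Apsd.
rewrite trmxCK AE !mulmxA mulmxV // mul1mx -mulmxA PP mulmx1.
by rewrite mxE eqxx.
Qed.

Lemma inv_sqrtmx_herm (C : numClosedFieldType) n (A : 'M[C]_n) :
  psdmx A -> (inv_sqrtmx A)^t* = inv_sqrtmx A.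
Proof.
move=> Apsd; rewrite /inv_sqrtmx invmx_unitary ?spectral_unitarymx //.
rewrite !adjmxM trmxCK diag_mx_adj ?mulmxA // => i.
by rewrite mxE invr_ge0 sqrtC_ge0 spectral_diag_ge0.
Qed.

(* Each entry of [P *m W], with [P] diagonalizing [A], either vanishes or pairs
   equal eigenvalues, so that any function of [A] acts through [l]. *)
Lemma inv_sqrtmx_eigen (C : numClosedFieldType) n p (A : 'M[C]_n)
    (W : 'M[C]_(n, p)) (l : 'rV[C]_p) :
  A \is normalmx -> A *m W = W *m diag_mx l ->
  inv_sqrtmx A *m W = W *m diag_mx (map_mx (fun x => (sqrtC x)^-1) l).
Proof.
move=> /orthomx_spectralP AE AW; rewrite /inv_sqrtmx.
have U := spectral_unit A; set P := spectralmx A in AE U *.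
set d := spectral_diag A in AE *.
have dV : diag_mx d *m (P *m W) = (P *m W) *m diag_mx l.
  by rewrite -[RHS]mulmxA -AW AE !mulmxA mulmxV // mul1mx.
rewrite -!mulmxA; apply: (can_inj (mulKmx U)); rewrite mulKVmx // [RHS]mulmxA.
move: (P *m W) dV => V dV.
apply/matrixP => i j; have /eqP := congr1 (fun M : 'M_(n, p) => M i j) dV.
rewrite !mul_diag_mx !mul_mx_diag !mxE (mulrC (V i j)).
rewrite -subr_eq0 -mulrBl mulf_eq0 subr_eq0 => /orP[/eqP ->|/eqP ->].
  by rewrite mulrC.
by rewrite mulr0 mul0r.
Qed.

(** * Pure bipartite states as matrices of amplitudes *)

Definition amplitude (C : numClosedFieldType) m k (Psi : 'cV[C]_(m * k)) :
    'M[C]_(m, k) :=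
  \matrix_(a, r) Psi (mxtens_index (a, r)) 0.

Lemma amplitude_onto (C : numClosedFieldType) m k (P : 'M[C]_(m, k)) :
  exists Psi : 'cV[C]_(m * k), amplitude Psi = P.
Proof.
exists (\col_x P (mxtens_unindex x).1 (mxtens_unindex x).2).
by apply/matrixP => a r; rewrite !mxE mxtens_indexK.
Qed.

Lemma amplitude_inj (C : numClosedFieldType) m k :
  injective (@amplitude C m k).
Proof.
move=> Psi Phi PP; apply/colP => x; rewrite -(mxtens_unindexK x).
have := congr1 (fun M : 'M_(m, k) =>
  M (mxtens_unindex x).1 (mxtens_unindex x).2) PP.
by rewrite !mxE.
Qed.

Lemma mulmx_ket_adjE (C : numClosedFieldType) n (Psi : 'cV[C]_n) x y :
  (Psi *m Psi^t* ) x y = Psi x 0 * (Psi y 0)^*.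
Proof. by rewrite mxE big_ord1 adjmxE. Qed.

Lemma ptrace2_ket (C : numClosedFieldType) m k (Psi : 'cV[C]_(m * k)) :
  ptrace2 (Psi *m Psi^t* ) = amplitude Psi *m (amplitude Psi)^t*.
Proof.
apply/matrixP => a b; rewrite summxE [RHS]mxE; apply: eq_bigr => r _.
by rewrite tens_blockE mulmx_ket_adjE adjmxE !mxE.
Qed.

Lemma ptrace1_ket (C : numClosedFieldType) m k (Psi : 'cV[C]_(m * k)) :
  ptrace1 (Psi *m Psi^t* ) = (amplitude Psi)^T *m ((amplitude Psi)^T)^t*.
Proof.
apply/matrixP => r s; rewrite summxE [RHS]mxE; apply: eq_bigr => a _.
by rewrite [LHS]mxE mulmx_ket_adjE adjmxE !mxE.
Qed.

Lemma tr_ptrace2 (C : numClosedFieldType) m k (X : 'M[C]_(m * k)) :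
  \tr (ptrace2 X) = \tr X.
Proof.
rewrite /mxtrace big_mxtens; apply: eq_bigr => a _.
by rewrite summxE; apply: eq_bigr => r _; rewrite tens_blockE.
Qed.

(** The entries of a pure state factor. Once the input indices are exchanged, the conjugated
    amplitude attaches to the row side of the observable and the other one to its column side. *)
Lemma ptranspose2_std_performance_pure (C : numClosedFieldType) dA dA'
    (t : test C dA dA') (Psi : 'cV[C]_(dA * test_refdim t)) :
  test_state t = Psi *m Psi^t* ->
  let P := (amplitude Psi)^T in
  ptranspose2_std (performance t) =
  (1%:M *t P^t* ) *m test_obs t *m (1%:M *t P).
Proof.
move=> tE P; apply: tens_block_inj => c d.
rewrite tens_block_ptranspose2_std tens_block_sandwich.
apply/matrixP => i j; rewrite tens_blockE performanceE summxE.
apply: eq_bigr => r _; rewrite summxE; apply: eq_bigr => s _.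
rewrite tE mulmx_ket_adjE !mxE [LHS]mulrC; congr (_ * _).
by rewrite mulrC.
Qed.

(** A Schmidt decomposition is a singular value decomposition of the amplitudes. The tensor product
    of kets is bilinear, hence [psi^T] and not [psi^t*]. *)
Lemma amplitude_schmidt (C : numClosedFieldType) m k (Psi : 'cV[C]_(m * k))
    (lam : 'rV[C]_m) (phi : 'M[C]_m) (psi : 'M[C]_(k, m)) :
  Psi = \sum_(n < m) sqrtC (lam 0 n) *: (col n phi *t col n psi) <->
  amplitude Psi = phi *m diag_mx (map_mx sqrtC lam) *m psi^T.
Proof.
have sumE : amplitude (\sum_(n < m) sqrtC (lam 0 n) *:
    (col n phi *t col n psi)) = phi *m diag_mx (map_mx sqrtC lam) *m psi^T.
  apply/matrixP => a r; rewrite mxE summxE [RHS]mxE; apply: eq_bigr => n _.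
  by rewrite mul_mx_diag !mxE mxtens_indexK /= mulrA (mulrC (phi a n)).
by split=> [->|PsiE] //; apply: amplitude_inj; rewrite PsiE.
Qed.

(** * Square roots and supports of diagonal spectra *)

Definition diag_sqrt (C : numClosedFieldType) n (lam : 'rV[C]_n) : 'M[C]_n :=
  diag_mx (map_mx sqrtC lam).

Definition diag_supp (C : numClosedFieldType) n (lam : 'rV[C]_n) : 'M[C]_n :=
  diag_mx (map_mx (fun x => (x != 0)%:R) lam).

Lemma diag_suppK (C : numClosedFieldType) n (lam : 'rV[C]_n) :
  diag_supp lam *m diag_supp lam = diag_supp lam.
Proof.
rewrite mulmx_diag; congr diag_mx; apply/rowP => i.
by rewrite !mxE -natrM mulnb andbb.
Qed.

Lemma diag_supp_sqrt (C : numClosedFieldType) n (lam : 'rV[C]_n) :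
  diag_supp lam *m diag_sqrt lam = diag_sqrt lam.
Proof.
rewrite mulmx_diag; congr diag_mx; apply/rowP => i; rewrite !mxE.
by have [->|_] := eqVneq (lam 0 i) 0; rewrite ?sqrtC0 ?mulr0 ?mul1r.
Qed.

Lemma diag_sqrt_supp (C : numClosedFieldType) n (lam : 'rV[C]_n) :
  diag_sqrt lam *m diag_supp lam = diag_sqrt lam.
Proof. by rewrite diag_mxC -/(diag_supp _) diag_supp_sqrt. Qed.

Lemma diag_sqrt_sqr (C : numClosedFieldType) n (lam : 'rV[C]_n) :
  diag_sqrt lam *m diag_sqrt lam = diag_mx lam.
Proof.
rewrite mulmx_diag; congr diag_mx; apply/rowP => i.
by rewrite !mxE -expr2 sqrtCK.
Qed.

Lemma diag_supp_diag (C : numClosedFieldType) n (lam : 'rV[C]_n) :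
  diag_supp lam *m diag_mx lam = diag_mx lam.
Proof. by rewrite -diag_sqrt_sqr mulmxA diag_supp_sqrt. Qed.

Lemma diag_diag_supp (C : numClosedFieldType) n (lam : 'rV[C]_n) :
  diag_mx lam *m diag_supp lam = diag_mx lam.
Proof. by rewrite diag_mxC -/(diag_supp _) diag_supp_diag. Qed.

(** As [0^-1 = 0], the product is the projector onto the nonzero part of the spectrum instead of the
    identity. *)
Lemma diag_sqrtV (C : numClosedFieldType) n (lam : 'rV[C]_n) :
  diag_sqrt lam *m diag_mx (map_mx (fun x => (sqrtC x)^-1) lam) = diag_supp lam.
Proof.
rewrite mulmx_diag; congr diag_mx; apply/rowP => i; rewrite !mxE.
have [->|l0] := eqVneq (lam 0 i) 0; first by rewrite sqrtC0 mul0r.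
by rewrite mulfV // sqrtC_eq0.
Qed.

Lemma diag_supp_adj (C : numClosedFieldType) n (lam : 'rV[C]_n) :
  (diag_supp lam)^t* = diag_supp lam.
Proof. by apply: diag_mx_adj => i; rewrite mxE ler0n. Qed.

Lemma diag_sqrt_adj (C : numClosedFieldType) n (lam : 'rV[C]_n) :
  (forall i, 0 <= lam 0 i) -> (diag_sqrt lam)^t* = diag_sqrt lam.
Proof. by move=> l0; apply: diag_mx_adj => i; rewrite mxE sqrtC_ge0. Qed.

(** * Existence of Schmidt decompositions, purifications and admissible states *)

Lemma spectral_decomp_ge0 (C : numClosedFieldType) n (tau : 'M[C]_n) lam phi i :
  psdmx tau -> spectral_decomp tau lam phi -> 0 <= lam 0 i.
Proof.
move=> tau0 [phiU tauE]; have := psdmx_sandwich_ge0 phi i tau0.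
have phiK : phi^t* *m phi = 1%:M.
  by rewrite -(invmx_unitary phiU) mulVmx // unitarymx_unit.
by rewrite tauE !mulmxA phiK mul1mx -mulmxA phiK mulmx1 mxE eqxx.
Qed.

Lemma eigen_isometryE (C : numClosedFieldType) m k (lam : 'rV[C]_m)
    (phi : 'M[C]_m) (psi : 'M[C]_(k, m)) :
  eigen_isometry lam phi psi = phi *m diag_supp lam *m psi^t*.
Proof.
apply/matrixP => a r; rewrite summxE [RHS]mxE big_mkcond.
apply: eq_bigr => n _; rewrite mul_mx_diag [in RHS]mxE [in RHS]mxE.
case: ifP => _; last by rewrite mulr0 mul0r.
by rewrite mxE big_ord1 !mxE mulr1.
Qed.

(** Compression by [diag_supp lam] erases the Gram entries of the unconstrained columns, so partial
    orthonormality becomes one matrix identity. *)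
Lemma schmidt_gram (C : numClosedFieldType) m k (lam : 'rV[C]_m)
    (psi : 'M[C]_(k, m)) :
  (forall a b, lam 0 a != 0 -> lam 0 b != 0 ->
     (psi^t* *m psi) a b = (a == b)%:R) <->
  diag_supp lam *m (psi^t* *m psi) *m diag_supp lam = diag_supp lam.
Proof.
split=> [orth|gram a b la lb].
  apply/matrixP => a b; rewrite mul_mx_diag mul_diag_mx.
  rewrite [LHS]mxE [in LHS]mxE.
  have [la|la] := eqVneq (lam 0 a) 0.
    by rewrite !mxE la eqxx !mul0r mul0rn.
  have [lb|lb] := eqVneq (lam 0 b) 0.
    rewrite !mxE lb eqxx mulr0.
    have [ab|_] := eqVneq a b; last by rewrite mulr0n.
    by rewrite ab lb eqxx in la.
  by rewrite orth // !mxE la lb mulr1 mul1r.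
have := congr1 (fun M : 'M_m => M a b) gram.
rewrite mul_mx_diag mul_diag_mx [in X in X -> _]mxE [in X in X -> _]mxE.
by rewrite ![map_mx _ _ _ _]mxE la lb mul1r mulr1 => ->; rewrite !mxE la.
Qed.

Lemma exists_schmidt_decomp (C : numClosedFieldType) m k (tau : 'M[C]_m)
    (Psi : 'cV[C]_(m * k)) lam phi :
  psdmx tau -> spectral_decomp tau lam phi -> purification tau Psi ->
  exists psi : 'M[C]_(k, m), schmidt_decomp Psi lam phi psi.
Proof.
move=> tau0 spec; have lam0 i := spectral_decomp_ge0 i tau0 spec.
have [phiU tauE] := spec; rewrite /purification ptrace2_ket => PP.
have phiK : phi^t* *m phi = 1%:M.
  by rewrite -(invmx_unitary phiU) mulVmx // unitarymx_unit.
set P := amplitude Psi in PP.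
set Di := diag_mx (map_mx (fun x => (sqrtC x)^-1) lam).
(* [G] solves [P = phi *m diag_sqrt lam *m G] on the support, so its transpose is the candidate for
   [psi]. *)
pose G := Di *m phi^t* *m P.
have DiE : Di^t* = Di.
  by apply: diag_mx_adj => i; rewrite mxE invr_ge0 sqrtC_ge0.
have GG : G *m G^t* = diag_supp lam.
  rewrite /G !adjmxM trmxCK DiE -!mulmxA (mulmxA P) PP tauE !mulmxA.
  rewrite -[_ *m phi^t* *m phi]mulmxA phiK mulmx1.
  rewrite -[_ *m phi^t* *m phi]mulmxA phiK mulmx1.
  rewrite -diag_sqrt_sqr -!mulmxA diag_sqrtV diag_sqrt_supp.
  by rewrite diag_mxC diag_sqrtV.
(* The part of [P] outside the support of [tau] vanishes, because its product with its own adjoint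
   is a compression of [tau] to the complement of that support. *)
have PE : P = phi *m diag_supp lam *m phi^t* *m P.
  apply/eqP; rewrite -subr_eq0; apply/eqP; apply: mulmx_adj_eq0.
  set E := phi *m diag_supp lam *m phi^t*.
  have -> : P - E *m P = (1%:M - E) *m P by rewrite mulmxBl mul1mx.
  rewrite adjmxM -mulmxA (mulmxA P) PP mulmxA mulmxBl mul1mx.
  have -> : E *m tau = tau.
    rewrite tauE /E !mulmxA -[_ *m phi^t* *m phi]mulmxA phiK mulmx1.
    by rewrite -[phi *m _ *m _]mulmxA diag_supp_diag.
  by rewrite subrr mul0mx.
exists G^T; split; last first.
  apply/amplitude_schmidt; rewrite trmxK -/P {1}PE /G -/(diag_sqrt lam).
  by rewrite !mulmxA -[_ *m _ *m Di]mulmxA diag_sqrtV.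
apply/schmidt_gram.
have -> : G^T^t* *m G^T = (G *m G^t* )^T.
  by move: (G) => H; rewrite trmx_mul [in RHS]map_trmx.
by rewrite GG tr_diag_mx !diag_suppK.
Qed.

Lemma exists_purification (C : numClosedFieldType) m (tau : 'M[C]_m) lam phi :
  psdmx tau -> spectral_decomp tau lam phi ->
  exists Psi : 'cV[C]_(m * m), purification tau Psi.
Proof.
move=> tau0 spec; have lam0 i := spectral_decomp_ge0 i tau0 spec.
have [_ tauE] := spec.
(* This is the Schmidt form with [psi] the computational basis of a copy of the input system. *)
have [Psi PsiE] := amplitude_onto (phi *m diag_sqrt lam).
exists Psi; rewrite /purification ptrace2_ket PsiE adjmxM diag_sqrt_adj //.
by rewrite mulmxA -[_ *m diag_sqrt lam]mulmxA diag_sqrt_sqr.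
Qed.

(** The maximally mixed state works for every [phi] and [X]: it is diagonal in each orthonormal
    basis and invertible. *)
Lemma exists_spectral_state (C : numClosedFieldType) dA dA' (phi : 'M[C]_dA)
    (X : 'M[C]_(dA' * dA)) :
  (0 < dA)%N -> phi \is unitarymx ->
  exists (tau : 'M[C]_dA) (lam : 'rV[C]_dA),
    [/\ densitymx tau, spectral_decomp tau lam phi &
        invertible_on_support ((1%:M : 'M[C]_dA') *t tau) X].
Proof.
move=> dA0 phiU; pose c : C := (dA%:R)^-1.
have c0 : 0 <= c by rewrite invr_ge0 ler0n.
have dAn0 : dA%:R != 0 :> C by rewrite pnatr_eq0 -lt0n.
exists (c%:M), (const_mx c); split.
- split; last by rewrite mxtrace_scalar -mulr_natl mulfV.
  split=> [|v].
    by apply/hermsymmxP; rewrite tr_scalar_mx map_scalar_mx /= geC0_conj.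
  rewrite mul_mx_scalar -scalemxAl mxE mulr_ge0 // mxE sumr_ge0 // => i _.
  by rewrite adjmxE mulrC mul_conjC_ge0.
- split=> //; rewrite diag_const_mx mul_mx_scalar -scalemxAl.
  by rewrite (unitarymxP phiU) scalemx1.
- have -> : (1%:M : 'M[C]_dA') *t c%:M = c%:M :> 'M_(dA' * dA).
    rewrite -[RHS]scalemx1 -tens1mx1; apply/matrixP => i j.
    by rewrite !mxE -[c *+ _]mulr_natr mulrCA.
  rewrite /invertible_on_support tr_scalar_mx.
  have -> : X^T = (c^-1 *: X^T) *m c%:M; last exact: submxMl.
  by rewrite mul_mx_scalar scalerA mulfV ?scale1r // invr_eq0.
Qed.

(** * The canonical test and its performance operator *)

(** Inclusion of supports means that [X] factors with [1%:M *t tau] on the left, and [E] fixes that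
    factor. *)
Lemma invertible_on_support_id (C : numClosedFieldType) dA dA'
    (tau E : 'M[C]_dA) (X : 'M[C]_(dA' * dA)) :
  E *m tau = tau -> invertible_on_support ((1%:M : 'M[C]_dA') *t tau) X ->
  (1%:M *t E) *m X = X.
Proof.
move=> Etau /submxP[Y XE].
have -> : X = (1%:M *t tau) *m Y^T by rewrite -[X]trmxK XE trmx_mul trmxK.
by rewrite mulmxA tens1mxM Etau.
Qed.

Lemma canonical_testP (C : numClosedFieldType) dA dA' (t : test C dA dA')
    (tau : 'M[C]_dA) (lam : 'rV[C]_dA) (phi : 'M[C]_dA) dR
    (Psi : 'cV[C]_(dA * dR)) (psi : 'M[C]_(dR, dA)) :
  let X := ptranspose2 phi (performance t) in
  let tauR := ptrace1 (Psi *m Psi^t* ) in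
  let T := eigen_isometry lam phi psi in
  let O := canonical_obs X T tauR in
  densitymx tau -> spectral_decomp tau lam phi ->
  invertible_on_support ((1%:M : 'M[C]_dA') *t tau) X ->
  purification tau Psi -> schmidt_decomp Psi lam phi psi ->
  [/\ partial_isometry T, T^t* *m tau *m T = tauR &
      exists (hPsi : densitymx (Psi *m Psi^t* )) (hO : O \is hermsymmx),
        test_equiv t (Test hPsi hO)].
Proof.
move=> X tauR T O [tau0 tau1] spec supp pur [/schmidt_gram gram].
move=> /amplitude_schmidt ampE.
have lam0 i := spectral_decomp_ge0 i tau0 spec; have [phiU tauE] := spec.
have phiK : phi^t* *m phi = 1%:M.
  by rewrite -(invmx_unitary phiU) mulVmx // unitarymx_unit.
have phiTK : phi^T *m (phi^T)^t* = 1%:M.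
  by apply/unitarymxP; rewrite trmx_unitary.
have TE : T = phi *m diag_supp lam *m psi^t* by exact: eigen_isometryE.
have TadjE : T^t* = psi *m diag_supp lam *m phi^t*.
  by rewrite TE !adjmxM trmxCK diag_supp_adj mulmxA.
have ampT : (amplitude Psi)^T = psi *m diag_sqrt lam *m phi^T.
  by rewrite ampE !trmx_mul trmxK tr_diag_mx mulmxA.
have tauRE : tauR = psi *m diag_mx lam *m psi^t*.
  rewrite /tauR ptrace1_ket ampT !adjmxM diag_sqrt_adj // -!mulmxA.
  by rewrite (mulmxA phi^T) phiTK mul1mx (mulmxA (diag_sqrt _)) diag_sqrt_sqr.
(* The columns of [psi] are orthonormal only where [lam] is nonzero, so a support projector has to
   be inserted before [gram] applies. *)
have supp_sqrt : diag_supp lam *m psi^t* *m (psi *m diag_sqrt lam)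
    = diag_sqrt lam.
  by rewrite -(diag_supp_sqrt lam) !mulmxA -(mulmxA (diag_supp _)) gram.
have tauR0 : psdmx tauR by rewrite /tauR ptrace1_ket; apply: psdmx_mul_adj.
pose S := inv_sqrtmx tauR.
(* The columns of [psi *m diag_sqrt lam] satisfy the eigenvector equation of [tauR] with values
   [lam], those with a zero coefficient being zero columns. *)
have SE : S *m (psi *m diag_sqrt lam) = psi *m diag_supp lam.
  rewrite (inv_sqrtmx_eigen (l := lam)); last 2 first.
  - by case: tauR0 => /hermitian_normalmx.
  - rewrite tauRE -{1}(diag_diag_supp lam) -!mulmxA (mulmxA (diag_supp _)).
    by rewrite supp_sqrt /diag_sqrt diag_mxC.
  by rewrite -mulmxA diag_sqrtV.
have SH : S^t* = S by exact: inv_sqrtmx_herm.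
have XH : X^t* = X by apply/ptranspose2_herm/performance_herm.
have hPsi : densitymx (Psi *m Psi^t* ).
  by split; [exact: psdmx_mul_adj|rewrite -tr_ptrace2 pur].
have hO : O \is hermsymmx.
  apply/hermsymmxP; move: (X) XH @O => Y YH O; rewrite /O /canonical_obs -/S.
  rewrite adjmxM (adjmxM _ Y) !tens1mx_adj YH (adjmxM S) (adjmxM T) trmxCK.
  by rewrite SH mulmxA.
split.
- rewrite /partial_isometry TadjE TE !mulmxA.
  rewrite -[_ *m phi^t* *m phi]mulmxA phiK mulmx1.
  rewrite -[_ *m psi^t* *m psi]mulmxA -!(mulmxA phi).
  by rewrite gram diag_suppK.
- rewrite TadjE TE tauE !mulmxA -[_ *m phi^t* *m phi]mulmxA phiK mulmx1.
  rewrite -[_ *m phi^t* *m phi]mulmxA phiK mulmx1 tauRE.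
  rewrite -(mulmxA psi) diag_supp_diag -(mulmxA psi).
  by rewrite diag_diag_supp.
exists hPsi, hO => N _; rewrite !score_performance; congr (pairing N _).
(* Partial transposition is injective, so it suffices to compare the transposed performance
   operators, where the purity of the new state can be used. *)
apply: (can_inj (@ptranspose2_stdK C dA' dA)).
rewrite (@ptranspose2_std_performance_pure _ _ _ (Test hPsi hO) Psi) //=.
pose E := phi *m diag_supp lam *m phi^t*.
have Etau : E *m tau = tau.
  rewrite tauE /E !mulmxA -[_ *m phi^t* *m phi]mulmxA phiK mulmx1.
  by rewrite -[phi *m _ *m _]mulmxA diag_supp_diag.
have EH : E^t* = E by rewrite /E !adjmxM trmxCK diag_supp_adj mulmxA.
have EX : (1%:M *t E) *m X = X := invertible_on_support_id Etau supp.
have XE : X *m (1%:M *t E) = X.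
  move: (X) XH EX => Y YH /(congr1 (fun Z : 'M_(dA' * dA) => Z^t* )).
  by rewrite adjmxM tens1mx_adj EH YH.
(* [S] cancels the square roots of the eigenvalues on the support, and [T] then carries each
   remaining [psi] vector to its [phi] vector. *)
have TSP : T *m S *m (amplitude Psi)^T = E *m (phi *m phi^T).
  rewrite ampT mulmxA -[_ *m S *m _]mulmxA SE TE /E -!mulmxA.
  congr (_ *m _); rewrite !mulmxA -[_ *m phi^t* *m phi]mulmxA phiK mulmx1.
  by rewrite -(mulmxA (diag_supp _)) gram.
rewrite /O /canonical_obs -/S.
have -> : S *m T^t* = (T *m S)^t* by rewrite adjmxM SH.
rewrite tens1mx_sandwich -adjmxM TSP.
(* [X] absorbs [E] on both sides; what is left of the sandwich is the unitary [phi *m phi^T], which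
   undoes the change of transposition basis in [ptranspose2E]. *)
rewrite (adjmxM E) EH -tens1mx_sandwich EX XE /X ptranspose2E tens1mx_sandwich.
have K : (phi *m phi^T)^t* *m (phi *m phi^T) = 1%:M.
  by rewrite adjmxM -mulmxA (mulmxA _ phi) phiK mul1mx mulmx1C.
by rewrite K tens1mx1 mul1mx mulmx1.
Qed.

Theorem theorem1 (R : realType) (dA dA' : nat) (t : test R[i] dA dA') :
  let Omega := performance t in
  (forall phi : 'M[R[i]]_dA, phi \is unitarymx ->
     exists (tau : 'M[R[i]]_dA) (lam : 'rV[R[i]]_dA),
       [/\ densitymx tau, spectral_decomp tau lam phi &
           invertible_on_support ((1%:M : 'M[R[i]]_dA') *t tau)
                                 (ptranspose2 phi Omega)]) /\
  (forall (tau : 'M[R[i]]_dA) (lam : 'rV[R[i]]_dA) (phi : 'M[R[i]]_dA),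
     densitymx tau -> spectral_decomp tau lam phi ->
     invertible_on_support ((1%:M : 'M[R[i]]_dA') *t tau)
                           (ptranspose2 phi Omega) ->
     (exists (dR : nat) (Psi : 'cV[R[i]]_(dA * dR)), purification tau Psi) /\
     (forall (dR : nat) (Psi : 'cV[R[i]]_(dA * dR)), purification tau Psi ->
        (exists psi : 'M[R[i]]_(dR, dA), schmidt_decomp Psi lam phi psi) /\
        (forall psi : 'M[R[i]]_(dR, dA), schmidt_decomp Psi lam phi psi ->
           let tauR := ptrace1 (Psi *m Psi^t* ) in
           let T := eigen_isometry lam phi psi in
           let O := canonical_obs (ptranspose2 phi Omega) T tauR in
           [/\ partial_isometry T,
               T^t* *m tau *m T = tauR &
               exists (hPsi : densitymx (Psi *m Psi^t* )) (hO : O \is hermsymmx),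
                 test_equiv t (Test hPsi hO)]))).
Proof.
move=> Omega; split=> [phi phiU|tau lam phi tauD spec supp].
  (* The input dimension is positive, since in dimension zero the state of the test would have trace
     zero instead of one. *)
  apply: exists_spectral_state phiU; rewrite lt0n; apply/eqP => dA0.
  have [_ /eqP] := test_stateP t; case: t {Omega} => k rho ob /= _ _.
  rewrite /mxtrace big_mxtens big1 ?(eq_sym 0) ?oner_eq0 // => a _.
  by have := ltn_ord a; rewrite [X in (_ < X)%N]dA0.
have [tau0 _] := tauD; split.
  by exists dA; apply: exists_purification tau0 spec.
move=> dR Psi pur; split; first exact: exists_schmidt_decomp tau0 spec pur.
by move=> psi sch; apply: canonical_testP sch.
Qed.
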